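(* Let $c > 2/9$ be a constant and let $U$ be a vertex subset of size $\lfloor cn^2\rfloor$ in the graph $J(n,3,\{1\})$. Then $U$ contains (induces) at least $$\left(\frac{9c^2}{2} - c + o(1)\right)n^3$$ edges of $J(n,3,\{1\})$, where $o(1)$ denotes a quantity depending only on $c$ and $n$ (not on the choice of $U$) that tends to $0$ as $n\to\infty$ with $c$ fixed.
   Context: The graph $J(n,3,\{1\})$ is the simple graph whose vertex set is the collection $\binom{[n]}{3}$ of all 3-element subsets of $[n]=\{1,\ldots,n\}$, in which two vertices are adjacent if and only if the corresponding 3-sets intersect in exactly one element. The edges contained in (induced by) a vertex subset $U$ are the edges of the graph with both endpoints in $U$. *)

(* Defs.v *)
From HB Require Import structures.
From mathcomp Require Import all_boot all_order all_algebra.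

Set Implicit Arguments.
Unset Strict Implicit.
Unset Printing Implicit Defensive.

(* The ground set {1, ..., n} is represented by 'I_n. *)
Definition triple (n : nat) : finType := {A : {set 'I_n} | #|A| == 3}.

(* J(n,3,{1}): the relation is symmetric, and irreflexive because a triple
   meets itself in 3 elements. *)
Definition J31 (n : nat) : rel (triple n) :=
  fun A B => #|val A :&: val B| == 1.

(* Edges are unordered pairs of vertices. *)
Definition edges_in (T : finType) (adj : rel T) (U : {set T}) : {set {set T}} :=
  [set [set A; B] | A in U, B in U & adj A B].

(* Main.v *)
(* Let d_x count the members of U through x and w_xy those through x and y.
   Since [k = 1] >= k - k(k - 1) for the size k of an intersection, twice the
   number of edges is at least sum_x d_x^2 - sum_(x != y) w_xy^2.

   Call x light if d_x = O(n).  In the link of a light x, the inequality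
   2 s min(a,b) <= s^2 + a b with s = sqrt n shows that the smaller of the two
   codegrees w_xy, w_xz of a member {x,y,z} is negligible on average, so that
   in effect a member has at most one large codegree at each of its light
   points.  It has only one in all if its three points are light, so in every
   case it contributes at most 2n + o(n) to sum_(x light, y) w_xy^2,
   which is thus at most (2 + o(1)) n |U|.  A heavy x costs at most 2n d_x,
   which the surplus of d_x^2 over the tangent line of the square at the average
   degree 3cn absorbs. *)
Require Import Defs.
From HB Require Import structures.
From mathcomp Require Import all_boot all_order all_algebra.
From mathcomp Require Import all_classical all_reals all_analysis.
From mathcomp Require Import ring lra.
Import Order.TTheory GRing.Theory Num.Theory.
Import numFieldNormedType.Exports.

Set Implicit Arguments.
Unset Strict Implicit.
Unset Printing Implicit Defensive.

Local Open Scope classical_set_scope.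
Local Open Scope ring_scope.

(** * Second moments of codegrees for a symmetric weight on triples *)

(** The right side minus the left is [(s - a) ^+ 2 + a * (b - a)]. *)
Lemma scaled_min_le (R : realFieldType) (s a b : R) :
  0 <= a <= b -> s * a *+ 2 <= s ^+ 2 + a * b.
Proof.
move=> /andP[a0 ab]; have := sqr_ge0 (s - a).
have : 0 <= a * (b - a) by rewrite mulr_ge0 // subr_ge0.
by rewrite mulr2n; nra.
Qed.

(* If all three points are light the largest codegree occurs twice on the left,
   otherwise at most two points do, so two terms [s * N] pay for the maxima
   and the remaining codegrees are at most minima at light points. *)
Lemma codegree_triangle (R : realFieldType) (N s a b c : R) (hx hy hz : bool) :
  0 < s -> 0 <= a <= N -> 0 <= b <= N -> 0 <= c <= N ->
  s * (hx%:R * (a + b) + hy%:R * (a + c) + hz%:R * (b + c)) <=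
  s * N *+ 2 + (hx%:R * (s ^+ 2 + a * b) + hy%:R * (s ^+ 2 + a * c)
    + hz%:R * (s ^+ 2 + b * c)).
Proof.
move=> s0 /andP[a0 aN] /andP[b0 bN] /andP[c0 cN].
have Ha : s * a <= s * N by rewrite ler_pM2l.
have Hb : s * b <= s * N by rewrite ler_pM2l.
have Hc : s * c <= s * N by rewrite ler_pM2l.
have := @scaled_min_le R s a b; have := @scaled_min_le R s b a.
have := @scaled_min_le R s a c; have := @scaled_min_le R s c a.
have := @scaled_min_le R s b c; have := @scaled_min_le R s c b.
rewrite a0 b0 c0 /= !mulr2n (mulrC b a) (mulrC c a) (mulrC c b) !mulrDr.
have ss : 0 <= s ^+ 2 by exact: sqr_ge0.
have p0 : 0 <= s * a by rewrite mulr_ge0 // ltW.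
have p1 : 0 <= a * b by exact: mulr_ge0.
have p2 : 0 <= a * c by exact: mulr_ge0.
have p3 : 0 <= b * c by exact: mulr_ge0.
(* The order of the codegrees decides which of the six instances have a true hypothesis; the others
   are discarded. *)
have [q1 | /ltW q1] := lerP a b; have [q2|/ltW q2] := lerP a c;
  have [q3|/ltW q3] := lerP b c;
  rewrite ?q1 ?q2 ?q3;
  repeat (let H := fresh "H" in
   first [move=> /(_ isT) H | move=> _]);
  case: hx; case: hy; case: hz; rewrite ?mul1r ?mul0r ?mulr0 ?addr0 ?add0r; lra.
Qed.

(** This is [codegree_triangle] at the codegrees of each ordered triple, weighted by [e] and summed.
    Since [e] is symmetric, the six terms on its left have equal sums, and so do the three
    light-point terms on its right: hence the factors 6 and 3. *)
Lemma codegree_sum (R : realFieldType) (n : nat) (e : 'I_n -> 'I_n -> 'I_n -> R)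
    (w := fun x y => \sum_z e x y z) (h : pred 'I_n) (s : R) :
  (forall x y z, e x y z = e y x z) -> (forall x y z, e x y z = e x z y) ->
  (forall x y z, 0 <= e x y z <= 1) -> 0 < s ->
  s * (\sum_(x | h x) \sum_y w x y ^+ 2) *+ 6 <=
  (s * n%:R *+ 2 + s ^+ 2 *+ 3) * (\sum_x \sum_y w x y)
  + (\sum_(x | h x) (\sum_y w x y) ^+ 2) *+ 3.
Proof.
move=> e12 e23 e01 s0.
have e0 x y z : 0 <= e x y z by case/andP: (e01 x y z).
have w0 x y : 0 <= w x y by apply: sumr_ge0.
have wC x y : w x y = w y x by apply: eq_bigr => z _.
have wn x y : w x y <= n%:R.
  rewrite -[n in n%:R]card_ord -sum1_card natr_sum; apply: ler_sum => z _.
  by case/andP: (e01 x y z).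
pose S (F : 'I_n -> 'I_n -> 'I_n -> R) := \sum_x \sum_y \sum_z e x y z * F x y z.
have S12 F : S F = S (fun x y z => F y x z).
  rewrite /S exchange_big; apply: eq_bigr => x _; apply: eq_bigr => y _.
  by apply: eq_bigr => z _; rewrite e12.
have S23 F : S F = S (fun x y z => F x z y).
  apply: eq_bigr => x _; rewrite exchange_big.
  by apply: eq_bigr => y _; apply: eq_bigr => z _; rewrite e23.
have SD F G : S (fun x y z => F x y z + G x y z) = S F + S G.
  rewrite /S -big_split; apply: eq_bigr => x _; rewrite -big_split.
  apply: eq_bigr => y _; rewrite -big_split; apply: eq_bigr => z _.
  by rewrite mulrDr.
have SZ k F : S (fun x y z => k * F x y z) = k * S F.
  rewrite /S mulr_sumr; apply: eq_bigr => x _; rewrite mulr_sumr.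
  apply: eq_bigr => y _; rewrite mulr_sumr; apply: eq_bigr => z _.
  by rewrite mulrCA.
have Sle F G : (forall x y z, F x y z <= G x y z) -> S F <= S G.
  move=> FG; apply: ler_sum => x _; apply: ler_sum => y _; apply: ler_sum => z _.
  exact: ler_wpM2l.
(* The two adjacent transpositions generate all permutations of the arguments. *)
have SP F : [/\ S (fun x y z => F x z y) = S F, S (fun x y z => F y x z) = S F,
    S (fun x y z => F y z x) = S F, S (fun x y z => F z x y) = S F
    & S (fun x y z => F z y x) = S F].
  have F12 := S12 F; have F23 := S23 F.
  have F1 := S12 (fun x y z => F x z y); have F2 := S23 (fun x y z => F y x z).
  have F3 := S12 (fun x y z => F z x y).
  by split; rewrite /= in F1 F2 F3 *; congruence.
pose A (x y z : 'I_n) := (h x)%:R * w x y.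
pose B x y z := (h x)%:R * (s ^+ 2 + w x y * w x z).
have SA : S A = \sum_(x | h x) \sum_y w x y ^+ 2.
  rewrite [RHS]big_mkcond; apply: eq_bigr => x _.
  under eq_bigr => y _ do rewrite -mulr_suml /A mulrCA.
  by rewrite -mulr_sumr; case: (h x); rewrite ?mul1r ?mul0r.
(* The weight is kept on [s ^+ 2], but bounded by 1 on the products [w x y * w x z], which then sum
   to the square of [\sum_y w x y]. *)
have SB : S B <= s ^+ 2 * (\sum_x \sum_y w x y) + \sum_(x | h x) (\sum_y w x y) ^+ 2.
  rewrite [X in _ + X]big_mkcond mulr_sumr -big_split /=.
  apply: ler_sum => x _; rewrite /B; case: (h x); last first.
    rewrite addr0 big1 => [|y _]; last by rewrite big1 // => z _; rewrite mul0r mulr0.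
    by apply: mulr_ge0; [exact: sqr_ge0 | exact: sumr_ge0].
  rewrite expr2 [X in _ <= _ + X]mulr_suml [X in _ <= X + _]mulr_sumr -big_split /=.
  apply: ler_sum => y _; rewrite [X in _ <= _ + X]mulr_sumr [X in _ <= X + _]mulr_sumr.
  rewrite -big_split /=; apply: ler_sum => z _.
  rewrite mul1r mulrDr mulrC lerD // ler_piMl ?mulr_ge0 //.
  by case/andP: (e01 x y z).
have S1 : S (fun _ _ _ => 1) = \sum_x \sum_y w x y.
  apply: eq_bigr => x _; apply: eq_bigr => y _; apply: eq_bigr => z _.
  by rewrite mulr1.
have : S (fun x y z => s * (A x y z + A x z y + A y x z + A y z x
         + A z x y + A z y x))
    <= S (fun x y z => s * n%:R *+ 2 * 1 + (B x y z + B y x z + B z x y)).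
  apply: Sle => x y z.
  have wP u v : 0 <= w u v <= n%:R by rewrite w0 wn.
  have := codegree_triangle (h x) (h y) (h z) s0 (wP x y) (wP x z) (wP y z).
  rewrite /A /B (wC y x) (wC z x) (wC z y) => H; apply: le_trans (le_trans H _).
    by rewrite le_eqVlt; apply/orP; left; apply/eqP; ring.
  by rewrite le_eqVlt; apply/orP; left; apply/eqP; ring.
rewrite SZ !SD SZ S1 SA.
have [-> -> -> -> ->] := SP A.
have [_ -> _ -> _] := SP B.
rewrite SA; move: SB; set X := S B; set Y := \sum_x \sum_y _.
set Z := \sum_(x | h x) \sum_y _; set V := \sum_(x | h x) _.
lra.
Qed.

(** * Orderings of the members of a family of triples *)

Definition ordered_triple n (x y z : 'I_n) (A : triple n) : bool :=
  [&& x != y, x != z, y != z, x \in val A, y \in val A & z \in val A].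

(* The 0/1 indicator that [x, y, z] is an ordering of a member of [U]; its sum
   over [z] is the codegree of [x] and [y], and [0] when [x = y]. *)
Definition triple_mult (R : realFieldType) n (U : {set triple n}) x y z : R :=
  \sum_(A in U) (ordered_triple x y z A)%:R.

(** Three distinct points exhaust a 3-set. *)
Lemma ordered_triple_inj n (x y z : 'I_n) (A B : triple n) :
  ordered_triple x y z A -> ordered_triple x y z B -> A = B.
Proof.
have E C : ordered_triple x y z C -> val C = [set x; y; z]%SET.
  case/and5P => xy xz yz xC /andP[yC zC]; apply/esym/eqP.
  rewrite eqEcard (eqP (valP C)) [(_ :|: _)%SET]finset.setUC cardsU1 cards2 !inE xy.
  rewrite negb_or ![z == _]eq_sym xz yz /= andbT.
  by apply/fintype.subsetP => u; rewrite !inE => /orP[/eqP-> | /orP[] /eqP->].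
by move=> /E EA /E EB; apply: val_inj; rewrite EA EB.
Qed.

Lemma triple_mult_bounds (R : realFieldType) n (U : {set triple n}) x y z :
  0 <= triple_mult R U x y z <= 1.
Proof.
rewrite /triple_mult -natr_sum ler0n -[X in _ <= X]/(1%:R) ler_nat /=.
rewrite -big_mkcondr sum1_card; apply/card_le1_eqP => A B.
by move=> /andP[_ HA] /andP[_ HB]; apply: ordered_triple_inj HB HA.
Qed.

Lemma triple_mult_swap12 (R : realFieldType) n (U : {set triple n}) x y z :
  triple_mult R U x y z = triple_mult R U y x z.
Proof.
apply: eq_bigr => A _; congr (nat_of_bool _)%:R.
rewrite /ordered_triple (eq_sym y x).
by case: (x != y) (x != z) (y != z) (x \in _) (y \in _) => [] [] [] [] [].
Qed.

Lemma triple_mult_swap23 (R : realFieldType) n (U : {set triple n}) x y z :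
  triple_mult R U x y z = triple_mult R U x z y.
Proof.
apply: eq_bigr => A _; congr (nat_of_bool _)%:R.
rewrite /ordered_triple (eq_sym z y).
by case: (x != y) (x != z) (y != z) (x \in _) (y \in _) (z \in _) => [] [] [] [] [] [].
Qed.

Lemma sum_triple_mult1 (R : realFieldType) n (U : {set triple n}) x y :
  \sum_z triple_mult R U x y z =
  \sum_(A in U) [&& x != y, x \in val A & y \in val A]%:R.
Proof.
rewrite exchange_big; apply: eq_bigr => A _.
rewrite -natr_sum -big_mkcond sum1_card; congr (_ %:R).
have [/and3P[xy xA yA] | xyA] := boolP [&& x != y, x \in val A & y \in val A].
  have := cardsD1 x (val A); have := cardsD1 y (val A :\ x).
  rewrite !inE xA yA eq_sym xy (eqP (valP A)) /= => -> /eqP.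
  rewrite !add1n !eqSS => /eqP k1; rewrite [RHS]k1; apply: eq_card => z.
  by rewrite !inE ![z == _]eq_sym andbCA.
rewrite eq_card0 // => z; rewrite unfold_in; apply/negP => /and5P[xy _ _ xA /andP[yA _]].
by rewrite xy xA yA in xyA.
Qed.

(** Each member through [x] is met once per order of its other two points, so the row sum of
    codegrees is twice the degree. *)
Lemma sum_triple_mult2 (R : realFieldType) n (U : {set triple n}) x :
  \sum_y \sum_z triple_mult R U x y z = (\sum_(A in U) (x \in val A)%:R) *+ 2.
Proof.
under eq_bigr do rewrite sum_triple_mult1.
rewrite exchange_big -sumrMnl; apply: eq_bigr => A _.
have [xA | xA] := boolP (x \in val A); last first.
  by rewrite mul0rn big1 // => y _; rewrite andbF.
rewrite -natr_sum -mulrnA -big_mkcond sum1_card; congr (_ %:R).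
have := cardsD1 x (val A); rewrite xA (eqP (valP A)) => -[k2].
by rewrite mul1n [RHS]k2; apply: eq_card => y; rewrite !inE eq_sym.
Qed.

Lemma sum_triple_mult3 (R : realFieldType) n (U : {set triple n}) :
  \sum_x \sum_y \sum_z triple_mult R U x y z = #|U|%:R *+ 6.
Proof.
under eq_bigr do rewrite sum_triple_mult2.
rewrite sumrMnl exchange_big -[6%N]/(3 * 2)%N mulrnA -sum1_card natr_sum.
congr (_ *+ 2); rewrite -sumrMnl; apply: eq_bigr => A _.
by rewrite -natr_sum -big_mkcond sum1_card; congr (_%:R); apply/eqP/(valP A).
Qed.

(** * From codegrees to edges *)

(** The map from adjacent ordered pairs to edges has fibres of size at most 2. *)
Lemma sum_adj_le_edges_in (T : finType) (adj : rel T) (U : {set T}) :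
  (\sum_(A in U) \sum_(B in U) adj A B <= #|edges_in adj U| * 2)%N.
Proof.
rewrite pair_big_dep /=.
pose P := [set p | [&& p.1 \in U, p.2 \in U & adj p.1 p.2]]%SET : {set T * T}.
pose f (p : T * T) := [set p.1; p.2]%SET.
have -> : edges_in adj U = [set f p | p in P]%SET.
  apply/finset.setP => S; apply/imset2P/finset.imsetP =>
    [[A B AU /[!inE] /andP[BU AB] ->] | [[A B]]].
    by exists (A, B); rewrite // inE AU BU.
  by rewrite inE => /and3P[AU BU AB] ->; exists A B; rewrite // inE BU.
rewrite (eq_bigr (fun p : T * T => if adj p.1 p.2 then 1 else 0)%N); last first.
  by move=> p _; case: (adj _ _).
rewrite -big_mkcondr (eq_bigl (mem P)); last by move=> p; rewrite !inE andbA.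
rewrite (partition_big_imset f) -sum_nat_const; apply: leq_sum => _ /finset.imsetP[[a b] _ ->].
rewrite sum1_card; apply: (@leq_trans #|[set (a, b); (b, a)]%SET|); last first.
  by rewrite cards2; case: (_ != _).
apply/subset_leq_card/fintype.subsetP => -[x y]; rewrite !inE => /andP[_ /eqP/finset.setP E].
move: (E a) (E b) (E x) (E y); rewrite !inE !eqxx /= ?orbT !xpair_eqE.
rewrite ![x == _]eq_sym ![y == _]eq_sym.
by case: (a == x) (a == y) (b == x) (b == y) => [] [] [] [].
Qed.

(** With [k] the size of [C], the double sum is [k * k.-1], which is at least [k] unless [k = 1]. *)
Lemma card_le_eq1_pairs (T : finType) (C : {set T}) :
  (#|C| <= (#|C| == 1) + \sum_x \sum_y [&& x != y, x \in C & y \in C])%N.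
Proof.
have -> : (\sum_x \sum_y [&& x != y, x \in C & y \in C] = #|C| * #|C|.-1)%N.
  rewrite -sum_nat_const [RHS]big_mkcond; apply: eq_bigr => x _ /=.
  case: ifP => xC; last by rewrite big1 // => y _; rewrite andbF.
  rewrite -big_mkcond sum1_card (cardsD1 x C) xC /=.
  by apply: eq_card => y; rewrite !inE eq_sym.
by case: #|C| => [|[|k]] //=; rewrite leq_pmulr.
Qed.

Lemma edges_in_J31_codegree (R : realFieldType) n (U : {set triple n})
    (w := fun x y => \sum_z triple_mult R U x y z) :
  \sum_x ((\sum_y w x y) ^+ 2 - (\sum_y w x y ^+ 2) *+ 4)
    <= #|edges_in (@J31 n) U|%:R *+ 8.
Proof.
pose d x : R := \sum_(A in U) (x \in val A)%:R.
have Ed : \sum_x d x ^+ 2 = \sum_(A in U) \sum_(B in U) #|val A :&: val B|%:R.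
  under eq_bigr do rewrite expr2 mulr_suml.
  rewrite exchange_big; apply: eq_bigr => A _.
  under eq_bigr do rewrite mulr_sumr.
  rewrite exchange_big; apply: eq_bigr => B _.
  rewrite -sum1_card natr_sum [RHS]big_mkcond; apply: eq_bigr => x _.
  by rewrite -natrM mulnb inE; case: (_ && _).
have Ew : \sum_x \sum_y w x y ^+ 2 = \sum_(A in U) \sum_(B in U)
    (\sum_x \sum_y [&& x != y, x \in val A :&: val B & y \in val A :&: val B])%:R.
  under eq_bigr do under eq_bigr do rewrite /w sum_triple_mult1 expr2 mulr_suml.
  under eq_bigr do rewrite exchange_big.
  rewrite exchange_big; apply: eq_bigr => A _ /=.
  under eq_bigr do under eq_bigr do rewrite mulr_sumr.
  under eq_bigr do rewrite exchange_big.
  rewrite exchange_big; apply: eq_bigr => B _ /=.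
  rewrite natr_sum. apply: eq_bigr => x _; rewrite natr_sum. apply: eq_bigr => y _.
  rewrite -natrM mulnb !inE.
  by case: (x != y) (x \in sval A) (x \in sval B) (y \in sval A) (y \in sval B) => [] [] [] [] [].
rewrite sumrB sumrMnl Ew.
(* Row sums are twice the degrees, so their squares carry a factor 4. It cancels throughout, leaving
   the 2 of ordered pairs. *)
under eq_bigr do rewrite sum_triple_mult2 -/(d _) -[_ *+ 2]mulr_natr exprMn -natrX mulr_natr.
rewrite sumrMnl Ed -mulrnBl -[8%N]/(2 * 4)%N (mulrnA _ 2 4) lerMn2r /=.
rewrite lerBlDr; set X := (X in _ <= _ + X).
apply: (@le_trans _ _ ((\sum_(A in U) \sum_(B in U) J31 A B)%:R + X)).
  rewrite /X natr_sum -big_split; apply: ler_sum => A _.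
  rewrite natr_sum -big_split; apply: ler_sum => B _ /=.
  by rewrite -natrD ler_nat card_le_eq1_pairs.
by rewrite lerD2r -mulrnA ler_nat sum_adj_le_edges_in.
Qed.

(** * The bound with a free parameter [s], then its limit form *)

Lemma codegree_le (R : realFieldType) n (U : {set triple n}) x y :
  0 <= \sum_z triple_mult R U x y z <= n%:R.
Proof.
rewrite sumr_ge0 /=; last by move=> z _; case/andP: (triple_mult_bounds R U x y z).
rewrite -[n in n%:R]card_ord -sum1_card natr_sum; apply: ler_sum => z _.
by case/andP: (triple_mult_bounds R U x y z).
Qed.

(** For [M] close to [c * N ^+ 2] and [s] the square root of [N], division by [8 * s] turns the
    first bracket into [9 * c ^+ 2 / 2 * N ^+ 3] and [8 * s * N * M] into [c * N ^+ 3], up to lower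
    order; the other two terms become [O(N ^+ 3 / s)]. *)
Lemma edges_in_J31_ge (R : realFieldType) n (U : {set triple n}) (c s : R)
    (K := 12 * c + 4) (N := n%:R : R) (M := #|U|%:R : R) :
  0 <= c -> 0 < s ->
  s * (72 * c * N * M - 36 * c ^+ 2 * N ^+ 3)
    - (8 * s * N * M + 12 * s ^+ 2 * M + 2 * K ^+ 2 * N ^+ 3)
    <= 8 * s * #|edges_in (@J31 n) U|%:R.
Proof.
move=> c0 s0; pose e := triple_mult R U.
pose w x y := \sum_z e x y z; pose D x := \sum_y w x y.
have N0 : 0 <= N by exact: ler0n.
have K0 : 0 <= K by rewrite /K; lra.
have w0 x y : 0 <= w x y by case/andP: (codegree_le R U x y).
have wN x y : w x y <= N by case/andP: (codegree_le R U x y).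
have D0 x : 0 <= D x by exact: sumr_ge0.
pose h := [pred x | D x <= K * N].
have He : \sum_x (D x ^+ 2 - (\sum_y w x y ^+ 2) *+ 4)
    <= #|edges_in (@J31 n) U|%:R *+ 8 := edges_in_J31_codegree R U.
have Hc : s * (\sum_(x | h x) \sum_y w x y ^+ 2) *+ 6
    <= (s * N *+ 2 + s ^+ 2 *+ 3) * (\sum_x D x) + (\sum_(x | h x) D x ^+ 2) *+ 3.
  by have := @codegree_sum R n e h s (triple_mult_swap12 R U) (triple_mult_swap23 R U)
    (triple_mult_bounds R U) s0.
(* Tangent line of [t ^+ 2] at [t = 6 c N], the average of [D x]. *)
have Hpt x : 12 * c * N * D x - 36 * c ^+ 2 * N ^+ 2
    - (if h x then \sum_y w x y ^+ 2 else 0) *+ 4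
    <= D x ^+ 2 - (\sum_y w x y ^+ 2) *+ 4.
  case: ifPn => [_ | /=]; first by have := sqr_ge0 (D x - 6 * c * N); lra.
  (* At a heavy point the codegree squares cost at most [4 * N * D x], while [D x ^+ 2] is at least
     [K * N * D x]; [K] is chosen so that [12 * c * N * D x] remains. *)
  rewrite -ltNge => HD.
  have W : \sum_y w x y ^+ 2 <= N * D x.
    rewrite mulr_sumr; apply: ler_sum => y _; rewrite expr2.
    exact: ler_wpM2r.
  have : 0 <= D x * (D x - K * N) by rewrite mulr_ge0 // subr_ge0 ltW.
  have := mulr_ge0 (sqr_ge0 c) (sqr_ge0 N).
  by rewrite /K; nra.
have ED : \sum_x D x = M *+ 6 := sum_triple_mult3 R U.
have HD : \sum_(x | h x) D x ^+ 2 <= N * (K * N) ^+ 2.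
  rewrite big_mkcond -[N in N * _]/(n%:R) -[n in n%:R]card_ord mulr_natl -sumr_const.
  apply: ler_sum => x _; case: ifP => [hx|_]; last exact: sqr_ge0.
  by rewrite ler_sqr ?nnegrE ?mulr_ge0.
have := le_trans (ler_sum (index_enum _) (fun x (_ : xpredT x) => Hpt x)) He.
rewrite !sumrB -mulr_sumr sumr_const card_ord sumrMnl -big_mkcond /=.
rewrite -[_ *+ n]mulr_natl -/N.
move: Hc HD; rewrite ED; set X := \sum_(x | _) _; set Y := \sum_(x | _) _.
set E : R := #|edges_in _ _|%:R => Hc HD H.
(* Two thirds of [Hc] bounds the term in [X *+ 4]. *)
have : s * (12 * c * N * (M *+ 6) - N * (36 * c ^+ 2 * N ^+ 2) - X *+ 4)
    <= s * (E *+ 8) by rewrite ler_pM2l.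
move: HD Hc; clearbody K N M X Y E; lra.
Qed.

Theorem theorem3 (R : realType) (c : R) (hc : 2%:R / 9%:R < c) :
  exists o1 : nat -> R,
    o1 @ \oo --> (0 : R) /\
    forall (n : nat) (U : {set triple n}),
      #|U|%:Z = Num.floor (c * n%:R ^+ 2) ->
      (9%:R * c ^+ 2 / 2%:R - c + o1 n) * n%:R ^+ 3
        <= #|edges_in (@J31 n) U|%:R.
Proof.
have c0 : 0 <= c by apply: ltW; apply: lt_trans hc; rewrite divr_gt0 ?ltr0n.
pose K := 12 * c + 4.
(* Here [8 * C] is [84 * c + 2 * K ^+ 2]: in the [c] part, 72 comes from the rounding of the floor
   and 12 from the term in [s ^+ 2 * M]. *)
pose C := 21%:R / 2%:R * c + K ^+ 2 / 4%:R.
exists (fun n => - C * Num.sqrt (n%:R^-1)); split.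
  rewrite -[X in _ --> X](mulr0 (- C)); apply: cvgMr.
  suff : Num.sqrt (n%:R^-1 : R) @[n --> \oo] --> Num.sqrt (0 : R) by rewrite sqrtr0.
  (* Shifting the index turns [n%:R^-1] into the harmonic sequence. *)
  rewrite -cvg_shiftS; apply: continuous_cvg; first exact: sqrt_continuous.
  exact: cvg_harmonic.
move=> n U hU; have [n0|n0] := posnP n.
  by rewrite [X in X%:R ^+ 3]n0 expr0n mulr0.
have N1 : 1 <= n%:R :> R by rewrite ler1n.
have hM : #|U|%:R = (Num.floor (c * n%:R ^+ 2))%:~R :> R by rewrite -hU.
have M1 : #|U|%:R <= c * n%:R ^+ 2 by rewrite hM floor_le.
have M2 : c * n%:R ^+ 2 - 1 <= #|U|%:R.
  by rewrite hM lerBlDr -intrD1 ltW // floorD1_gt.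
rewrite sqrtrV ?ler0n //; set s := Num.sqrt n%:R.
have s2 : s ^+ 2 = n%:R by rewrite sqr_sqrtr ?ler0n.
have s1 : 1 <= s by rewrite -sqrtr1 ler_sqrt ?ler0n.
have s0 : 0 < s by exact: lt_le_trans s1.
have := edges_in_J31_ge U c0 s0.
set E : R := #|edges_in _ _|%:R.
move: M1 M2; set M : R := #|U|%:R; rewrite -/K; set N : R := n%:R in N1 s2 *.
move=> M1 M2 HE; have N0 : 0 < N by exact: lt_le_trans N1.
have H1 : c * s * N * (c * N ^+ 2 - 1) <= c * s * N * M.
  by rewrite ler_wpM2l // !mulr_ge0 // ltW.
have H2 : s * N * M <= s * N * (c * N ^+ 2) by rewrite ler_wpM2l // mulr_ge0 // ltW.
have H3 : s ^+ 2 * M <= N * (c * N ^+ 2) by rewrite s2 ler_wpM2l // ltW.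
(* The rounding error is absorbed because [s <= s ^+ 4 = N ^+ 2]. *)
have H4 : c * (s * N) <= c * N ^+ 3.
  rewrite ler_wpM2l // exprSr ler_pM2r // -s2 -exprM -[leLHS]expr1.
  exact: ler_weXn2l.
rewrite -(ler_pM2l (_ : 0 < 8 * s)) ?mulr_gt0 //; apply: le_trans HE.
have -> : 8 * s * ((9 * c ^+ 2 / 2 - c + - C * s^-1) * N ^+ 3)
    = s * (36 * c ^+ 2 - 8 * c) * N ^+ 3 - 8 * C * N ^+ 3.
  by field; rewrite gt_eqF.
rewrite /C; move: H1 H2 H3 H4; clearbody K E M N s; lra.
Qed.
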